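(* Let $f\colon(X,\varphi)\to(Y,\psi)$ be an $s$-resolving map of Smale spaces. Suppose $a_0,\ldots,a_n\in X$ are points such that $f(a_0)\sim_u f(a_k)$ for all $k$. Then there are points $b_0,\ldots,b_n\in X$ satisfying $$a_k\sim_u b_k,\qquad f(b_0)=f(b_k)$$ for $k=0,\dots,n$.
   Context: A Smale space $(X,\varphi)$ is a compact metric space $(X,d)$ with a homeomorphism $\varphi\colon X\to X$ such that: (i) there are $\epsilon_X>0$ and a continuous map $\{(x,y): d(x,y)\le\epsilon_X\}\to X$, $(x,y)\mapsto[x,y]$, with $[x,x]=x$, $[x,[y,z]]=[x,z]$, $[[x,y],z]=[x,z]$, $\varphi([x,y])=[\varphi(x),\varphi(y)]$ whenever both sides are defined; (ii) there is $0<\lambda<1$ such that, whenever the brackets are defined, $[x,y]=y$ implies $d(\varphi(x),\varphi(y))\le\lambda d(x,y)$, and $[x,y]=x$ implies $d(\varphi^{-1}(x),\varphi^{-1}(y))\le\lambda d(x,y)$. Smale spaces are assumed non-wandering: for every nonempty open $U$ there is $N\geq 1$ with $U\cap\varphi^N(U)\ne\emptyset$. Write $x\sim_s y$ if $d(\varphi^n(x),\varphi^n(y))\to0$, and $x\sim_u y$ if $d(\varphi^{-n}(x),\varphi^{-n}(y))\to0$, as $n\to\infty$; $X^s(x)$ is the $\sim_s$-class of $x$. A factor map $f\colon(X,\varphi)\to(Y,\psi)$ is a continuous surjection with $f\circ\varphi=\psi\circ f$; it is $s$-resolving if it restricts to an injective map $X^s(x)\to Y^s(f(x))$ for each $x\in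 X$. *)

(* Defs.v *)
From HB Require Import structures.
From mathcomp Require Import all_boot all_order all_algebra.
From mathcomp Require Import all_classical all_reals all_analysis.

Set Implicit Arguments.
Unset Strict Implicit.
Unset Printing Implicit Defensive.

Import Order.TTheory GRing.Theory Num.Theory.
Import numFieldNormedType.Exports.

Local Open Scope classical_set_scope.
Local Open Scope ring_scope.

(* [smap] and [smapV] are the homeomorphism and its inverse.  [bracket] is a
   total function, but nothing is assumed about [bracket x y] unless
   [mdist x y <= eps]: it stands for an arbitrary extension of the partial
   bracket, whose domain is the closed eps-neighbourhood of the diagonal. *)
Record smaleSpace (R : realType) := SmaleSpace {
  spoint :> metricType R ;
  smap : spoint -> spoint ;
  smapV : spoint -> spoint ;
  eps : R ;
  bracket : spoint -> spoint -> spoint ;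
  lambda : R ;
  spoint_compact : compact [set: spoint] ;
  smapK : cancel smap smapV ;
  smapVK : cancel smapV smap ;
  smap_continuous : continuous smap ;
  smapV_continuous : continuous smapV ;
  eps_gt0 : 0 < eps ;
  bracket_continuous :
    {within [set p : spoint * spoint | mdist p.1 p.2 <= eps],
      continuous (fun p : spoint * spoint => bracket p.1 p.2)} ;
  bracketxx : forall x, bracket x x = x ;
  bracket_bracketr : forall x y z,
    mdist y z <= eps -> mdist x (bracket y z) <= eps -> mdist x z <= eps ->
    bracket x (bracket y z) = bracket x z ;
  bracket_bracketl : forall x y z,
    mdist x y <= eps -> mdist (bracket x y) z <= eps -> mdist x z <= eps ->
    bracket (bracket x y) z = bracket x z ;
  smap_bracket : forall x y,
    mdist x y <= eps -> mdist (smap x) (smap y) <= eps ->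
    smap (bracket x y) = bracket (smap x) (smap y) ;
  lambda_gt0 : 0 < lambda ;
  lambda_lt1 : lambda < 1 ;
  smap_contract : forall x y,
    mdist x y <= eps -> bracket x y = y ->
    mdist (smap x) (smap y) <= lambda * mdist x y ;
  smapV_contract : forall x y,
    mdist x y <= eps -> bracket x y = x ->
    mdist (smapV x) (smapV y) <= lambda * mdist x y ;
  smap_nonwandering : forall U : set spoint, open U -> U !=set0 ->
    exists2 N : nat, (1 <= N)%N & U `&` (iter N smap @` U) !=set0
}.

Definition stable_equiv (R : realType) (X : smaleSpace R) (x y : X) : Prop :=
  (fun n : nat => mdist (iter n (@smap R X) x) (iter n (@smap R X) y))
    @ \oo --> (0 : R).

Definition unstable_equiv (R : realType) (X : smaleSpace R) (x y : X) : Prop :=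
  (fun n : nat => mdist (iter n (@smapV R X) x) (iter n (@smapV R X) y))
    @ \oo --> (0 : R).

Definition stable_class (R : realType) (X : smaleSpace R) (x : X) : set X :=
  [set y | stable_equiv x y].

Record factor_map (R : realType) (X Y : smaleSpace R) (f : X -> Y) : Prop := {
  factor_continuous : continuous f ;
  factor_surjective : set_surj [set: X] [set: Y] f ;
  factor_equivariant : forall x, f (smap x) = smap (f x)
}.

Record s_resolving (R : realType) (X Y : smaleSpace R) (f : X -> Y) : Prop := {
  s_resolving_factor : factor_map f ;
  s_resolving_fun :
    forall x : X, set_fun (stable_class x) (stable_class (f x)) f ;
  s_resolving_inj : forall x : X, set_inj (stable_class x) f
}.

(* Main.v *)
Require Import Defs.
From mathcomp Require Import all_boot all_order all_algebra.
From mathcomp Require Import all_classical all_reals all_analysis.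
From mathcomp Require Import ring.

Set Implicit Arguments.
Unset Strict Implicit.
Unset Printing Implicit Defensive.

Import Order.TTheory GRing.Theory Num.Theory.
Import numFieldNormedType.Exports.
Import metricType_numDomainType.

Local Open Scope classical_set_scope.
Local Open Scope ring_scope.

(** Let S be the homeomorphism of either space and V its inverse.  Since the
    points f (a_k) are unstably equivalent, the points f (V^N a_k) get
    arbitrarily close to each other as N grows.  By compactness the tuples
    (V^N a_k)_k accumulate at some tuple (c_k)_k, and then f (c_k) is
    independent of k by continuity.  Fix N such that every V^N a_k is close to
    c_k and such that the backward orbits of the points f (V^N a_k) stay close
    to each other, and put
<<
      w_k = [c_k, V^N a_k],   b_k = S^N w_k.
>>
    The bracket lies on the local unstable set of V^N a_k, so a_k and b_k are
    unstably equivalent.  It also lies on the local stable set of c_k.  Hence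
    the forward orbit of f (w_k) follows that of f (c_k), which does not depend
    on k, while its backward orbit follows that of f (V^N a_k), and these are
    all close to each other.  So the full orbits of f (w_0) and f (w_k) stay
    close, and f (w_0) = f (w_k) because the dynamics on Y is expansive.

    The lemma [expansive] provides the last step, [factor_bracket_eq] combines
    it with the two shadowing estimates, and the limit tuple is obtained along
    an ultrafilter on the indices N, so that all n + 1 sequences converge
    simultaneously. *)

(** * Compactness *)

Lemma fmap_ultra (T U : Type) (f : T -> U) (F : set_system T) :
  UltraFilter F -> UltraFilter (f @ F).
Proof.
move=> FU; split=> [|H PH FH]; first exact: fmap_proper_filter.
apply/seteqP; split=> // A HA.
have [//|nA] := in_ultra_setVsetC (f @^-1` A) FU.
have : H (~` A) by exact: FH.
by move=> /(filterI HA); rewrite setICr => /filter_not_empty.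
Qed.

(** A property that holds locally at each diagonal point holds uniformly near
    the diagonal of a compact space.  This is the Lebesgue number argument: it
    yields below both uniform continuity and uniform bounds on the bracket. *)
Lemma compact_near_diagonal (R : realType) (M : metricType R)
    (P : M -> M -> Prop) : compact [set: M] ->
  (forall x, \forall p \near ((x, x) : M * M), P p.1 p.2) ->
  exists2 e : R, 0 < e & forall x y, mdist x y <= e -> P x y.
Proof.
move=> /compact_near_coveringP cM nearP.
pose Q (e : R) (x : M) := forall y, mdist x y <= e -> P x y.
have QF : \forall e \near 0^'+, [set: M] `<=` Q e.
  apply: cM => x _; have [[A B] /= [xA xB] AB] := nearP x.
  have /nbhs_mdistP[r /= r0 rAB] : nbhs x (A `&` B) by exact: filterI.
  have r20 : 0 < r / 2 by rewrite divr_gt0.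
  exists ([set z | mdist x z < r / 2], [set e : R | e < r / 2]) => /=.
    by split; [apply/nbhs_mdistP; exists (r / 2) | exact: nbhs_right_lt].
  move=> [z e] /= [xz er] y zy.
  have xzr : mdist x z < r.
    by rewrite (lt_trans xz)// ltr_pdivrMr// ltr_pMr// ltr1n.
  have xyr : mdist x y < r.
    by rewrite (le_lt_trans (metric_triangle _ z _))// (splitr r) ltrD//
      (le_lt_trans zy).
  apply: (AB (z, y)); split => /=.
    exact: (proj1 (rAB _ xzr)).
  exact: (proj2 (rAB _ xyr)).
near (0 : R)^'+ => e; exists e; first by near: e; exact: nbhs_right_gt.
move=> x; have : [set: M] `<=` Q e by near: e.
exact.
Unshelve. all: by end_near. Qed.

Lemma compact_unif_continuous_mdist (R : realType) (M N : metricType R)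
    (f : M -> N) : compact [set: M] -> continuous f -> forall e : R, 0 < e ->
  exists2 r : R, 0 < r & forall x y, mdist x y <= r -> mdist (f x) (f y) <= e.
Proof.
move=> cM fc e e0; apply: compact_near_diagonal => // x.
have e20 : 0 < e / 2 by rewrite divr_gt0.
have xe := cvgr_dist_le (fc x) e20.
exists ([set z | mdist (f x) (f z) <= e / 2],
        [set z | mdist (f x) (f z) <= e / 2]); first by split; exact: xe.
move=> -[y z] /= [xy xz].
rewrite (le_trans (metric_triangle _ (f x) _))// (splitr e) lerD//.
by rewrite metric_sym.
Qed.

(** * Dynamics of a Smale space *)

Section SmaleSpace.
Context {R : realType} (X : smaleSpace R).
Local Notation S := (@smap R X).
Local Notation V := (@smapV R X).
Implicit Types x y : X.

Lemma iter_smapVK n : cancel (iter n V) (iter n S).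
Proof. by elim: n => // n IH x; rewrite iterSr iterS smapVK IH. Qed.

Lemma iter_smapK n : cancel (iter n S) (iter n V).
Proof. by elim: n => // n IH x; rewrite iterSr iterS smapK IH. Qed.

Lemma smapV_bracket x y : mdist x y <= eps X ->
  mdist (V x) (V y) <= eps X -> V (bracket x y) = bracket (V x) (V y).
Proof.
by move=> xy Vxy; apply: (can_inj (@smapK _ X));
  rewrite smap_bracket// !smapVK.
Qed.

Lemma iter_smap_bracket x y n :
  (forall m, (m <= n)%N -> mdist (iter m S x) (iter m S y) <= eps X) ->
  iter n S (bracket x y) = bracket (iter n S x) (iter n S y).
Proof.
elim: n => // n IH xy.
rewrite iterS IH => [|m mn]; last exact/xy/leqW.
by rewrite smap_bracket//; [exact: xy | exact: (xy n.+1)].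
Qed.

Lemma iter_smapV_bracket x y n :
  (forall m, (m <= n)%N -> mdist (iter m V x) (iter m V y) <= eps X) ->
  iter n V (bracket x y) = bracket (iter n V x) (iter n V y).
Proof.
elim: n => // n IH xy.
rewrite iterS IH => [|m mn]; last exact/xy/leqW.
by rewrite smapV_bracket//; [exact: xy | exact: (xy n.+1)].
Qed.

Lemma lambda_exp_mdist_le x y n : lambda X ^+ n * mdist x y <= mdist x y.
Proof.
by rewrite ler_piMl ?mdist_ge0// exprn_ile1// ltW// ?lambda_gt0// lambda_lt1.
Qed.

(** The relation [[x, y] = y] is preserved by the homeomorphism, since the
    contraction keeps the images within the domain of the bracket; the
    contraction can therefore be iterated. *)
Lemma stable_contract x y : mdist x y <= eps X -> bracket x y = y ->
  forall n, mdist (iter n S x) (iter n S y) <= lambda X ^+ n * mdist x y.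
Proof.
move=> xy bxy n.
suff [] : mdist (iter n S x) (iter n S y) <= lambda X ^+ n * mdist x y /\
  bracket (iter n S x) (iter n S y) = iter n S y by [].
elim: n => [|n [IH bn]]; first by rewrite expr0 mul1r.
have xyn := le_trans IH (le_trans (lambda_exp_mdist_le _ _ _) xy).
have xySn :
    mdist (iter n.+1 S x) (iter n.+1 S y) <= lambda X ^+ n.+1 * mdist x y.
  rewrite !iterS (le_trans (smap_contract xyn bn))// exprS -mulrA.
  by rewrite ler_pM2l ?lambda_gt0.
split=> //; rewrite !iterS -smap_bracket ?bn//.
exact: le_trans xySn (le_trans (lambda_exp_mdist_le _ _ _) xy).
Qed.

(** The time reversal of [stable_contract]. *)
Lemma unstable_contract x y : mdist x y <= eps X -> bracket x y = x ->
  forall n, mdist (iter n V x) (iter n V y) <= lambda X ^+ n * mdist x y.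
Proof.
move=> xy bxy n.
suff [] : mdist (iter n V x) (iter n V y) <= lambda X ^+ n * mdist x y /\
  bracket (iter n V x) (iter n V y) = iter n V x by [].
elim: n => [|n [IH bn]]; first by rewrite expr0 mul1r.
have xyn := le_trans IH (le_trans (lambda_exp_mdist_le _ _ _) xy).
have xySn :
    mdist (iter n.+1 V x) (iter n.+1 V y) <= lambda X ^+ n.+1 * mdist x y.
  rewrite !iterS (le_trans (smapV_contract xyn bn))// exprS -mulrA.
  by rewrite ler_pM2l ?lambda_gt0.
split=> //; rewrite !iterS -smapV_bracket ?bn//.
exact: le_trans xySn (le_trans (lambda_exp_mdist_le _ _ _) xy).
Qed.

Lemma cvg_lambda_exp (c : R) : (fun n => lambda X ^+ n * c) @ \oo --> (0 : R).
Proof.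
rewrite -[X in _ --> X](mul0r c); apply: cvgMl; apply: cvg_expr.
by rewrite gtr0_norm ?lambda_gt0 ?lambda_lt1.
Qed.

Lemma lambda_exp_mdist_eq x y (c : R) :
  (forall n, mdist x y <= lambda X ^+ n * c) -> x = y.
Proof.
move=> xy; apply: mdist_positivity; apply/eqP; rewrite eq_le mdist_ge0 andbT.
by apply: (cvgr_to_ge (cvg_lambda_exp c)); exact: nearW.
Qed.

Lemma unstable_contract_equiv x y :
  mdist x y <= eps X -> bracket x y = x -> unstable_equiv x y.
Proof.
move=> xy bxy; apply: (squeeze_cvgr _ (cvg_cst 0) (cvg_lambda_exp (mdist x y))).
by apply: nearW => n; rewrite mdist_ge0 unstable_contract.
Qed.

Lemma unstable_equiv_sym x y : unstable_equiv x y -> unstable_equiv y x.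
Proof.
by rewrite /unstable_equiv; under eq_fun do rewrite metric_sym.
Qed.

Lemma unstable_equiv_iter_smap x y n :
  unstable_equiv x y -> unstable_equiv (iter n S x) (iter n S y).
Proof.
move=> xy; rewrite /unstable_equiv -(cvg_shiftn n) /=.
by under eq_fun do rewrite !iterD !iter_smapK.
Qed.

(** Uniform continuity of the bracket at the diagonal, where it satisfies
    [[x, x] = x].  The bounds are what the bracket identities need as side
    conditions. *)
Lemma bracket_near_diagonal (d : R) : 0 < d ->
  exists2 e : R, 0 < e & forall x y, mdist x y <= e ->
    [/\ mdist x y <= eps X, mdist x (bracket x y) <= d
      & mdist (bracket x y) y <= d].
Proof.
move=> d0; apply: compact_near_diagonal; first exact: spoint_compact.
move=> x; have d20 : 0 < d / 2 by rewrite divr_gt0.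
have x0 : [set p : X * X | mdist p.1 p.2 <= eps X] (x, x).
  by rewrite /= mdistxx ltW// eps_gt0.
have : (fun p : X * X => bracket p.1 p.2)
    @ within [set p : X * X | mdist p.1 p.2 <= eps X] (nbhs (x, x)) --> x.
  rewrite -[X in _ --> X]bracketxx.
  exact: (iffLR (subspace_continuousP _ _) (@bracket_continuous R X) (x, x) x0).
move=> /cvgr_dist_le/(_ _ d20); rewrite near_withinE => bxx.
have close (r : R) : 0 < r -> \forall p \near ((x, x) : X * X),
    mdist x p.1 <= r /\ mdist x p.2 <= r.
  move=> r0; have xr : \forall z \near x, mdist x z <= r.
    by apply: (cvgr_dist_le (f := id)) => //; exact: cvg_id.
  exists ([set z | mdist x z <= r], [set z | mdist x z <= r]); last by case.
  by split; exact: xr.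
have e20 : 0 < eps X / 2 by rewrite divr_gt0// eps_gt0.
near=> p.
have [p1d p2d] : mdist x p.1 <= d / 2 /\ mdist x p.2 <= d / 2.
  by near: p; exact: close.
have pe : mdist p.1 p.2 <= eps X.
  have [p1e p2e] : mdist x p.1 <= eps X / 2 /\ mdist x p.2 <= eps X / 2.
    by near: p; exact: close.
  rewrite (le_trans (metric_triangle _ x _))// (splitr (eps X)) lerD//.
  by rewrite metric_sym.
have bd : mdist x (bracket p.1 p.2) <= d / 2.
  by move: pe; near: p.
by split=> //; rewrite (le_trans (metric_triangle _ x _))// (splitr d) lerD//
  metric_sym.
Unshelve. all: by end_near. Qed.

(** Closeness of the backward orbits of [x] and [y] forces [x = [x, y]]: the
    points [V^n x] and [[V^n x, V^n y] = V^n [x, y]] are on the same local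
    stable set at a bounded distance, and pushing them forward [n] times
    contracts that distance by [lambda ^ n].  Symmetrically, closeness of the
    forward orbits forces [[x, y] = y]. *)
Lemma expansive : exists2 e : R, 0 < e & forall x y,
  (forall n, mdist (iter n S x) (iter n S y) <= e) ->
  (forall n, mdist (iter n V x) (iter n V y) <= e) -> x = y.
Proof.
have [e e0 he] := bracket_near_diagonal (eps_gt0 X).
exists e => // x y fwd bwd.
have -> : x = bracket x y.
  apply: (@lambda_exp_mdist_eq _ _ (eps X)) => n.
  have [xyn xwn wyn] := he _ _ (bwd n).
  have wE : iter n V (bracket x y) = bracket (iter n V x) (iter n V y).
    by apply: iter_smapV_bracket => m _; have [] := he _ _ (bwd m).
  have bn : bracket (iter n V x) (iter n V (bracket x y))
      = iter n V (bracket x y) by rewrite wE bracket_bracketr.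
  rewrite -wE in xwn.
  have := stable_contract xwn bn n; rewrite !iter_smapVK => /le_trans; apply.
  by rewrite ler_pM2l// exprn_gt0// lambda_gt0.
apply: (@lambda_exp_mdist_eq _ _ (eps X)) => n.
have [xyn xwn wyn] := he _ _ (fwd n).
have wE : iter n S (bracket x y) = bracket (iter n S x) (iter n S y).
  by apply: iter_smap_bracket => m _; have [] := he _ _ (fwd m).
have bn : bracket (iter n S (bracket x y)) (iter n S y)
    = iter n S (bracket x y) by rewrite wE bracket_bracketl.
rewrite -wE in wyn.
have := unstable_contract wyn bn n; rewrite !iter_smapK => /le_trans; apply.
by rewrite ler_pM2l// exprn_gt0// lambda_gt0.
Qed.

End SmaleSpace.

(** * Factor maps *)

Section FactorMap.
Context {R : realType} {X Y : smaleSpace R} (f : X -> Y) (hf : factor_map f).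

Lemma factor_iter_smap n x :
  f (iter n (@smap R X) x) = iter n (@smap R Y) (f x).
Proof. by elim: n => //= n <-; rewrite (factor_equivariant hf). Qed.

Lemma factor_iter_smapV n x :
  f (iter n (@smapV R X) x) = iter n (@smapV R Y) (f x).
Proof.
by apply: (can_inj (@iter_smapK _ Y n)); rewrite -factor_iter_smap !iter_smapVK.
Qed.

(** The point [f [c_i, a_i]] shadows [f c_i] forward and [f a_i] backward, so
    the two images have close full orbits and expansiveness identifies them. *)
Lemma factor_bracket_eq : exists2 r : R, 0 < r & exists2 e : R, 0 < e &
  forall c0 c1 a0 a1 : X, f c0 = f c1 ->
    mdist c0 a0 <= r -> mdist c1 a1 <= r ->
    (forall n, mdist (iter n (@smapV R Y) (f a0))
                     (iter n (@smapV R Y) (f a1)) <= e) ->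
    f (bracket c0 a0) = f (bracket c1 a1).
Proof.
have [e e0 he] := expansive Y.
have e30 : 0 < e / 3 by rewrite divr_gt0.
have [d d0 hd] := compact_unif_continuous_mdist (@spoint_compact _ X)
  (factor_continuous hf) e30.
have de0 : 0 < Num.min d (eps X) by rewrite lt_min d0 eps_gt0.
have [r r0 hr] := bracket_near_diagonal X de0.
exists r => //; exists (e / 3) => // c0 c1 a0 a1 fc ca0 ca1 ae.
have fwd c a n : mdist c a <= r ->
    mdist (iter n (@smap R Y) (f c)) (iter n (@smap R Y) (f (bracket c a)))
    <= e / 3.
  move=> /hr[ca]; rewrite !le_min => /andP[cwd cwe] _.
  rewrite -!factor_iter_smap; apply: hd; apply: le_trans cwd.
  apply: le_trans (lambda_exp_mdist_le _ _ n).
  by apply: stable_contract; rewrite ?bracket_bracketr.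
have bwd c a n : mdist c a <= r ->
    mdist (iter n (@smapV R Y) (f (bracket c a))) (iter n (@smapV R Y) (f a))
    <= e / 3.
  move=> /hr[ca _]; rewrite !le_min => /andP[wad wae].
  rewrite -!factor_iter_smapV; apply: hd; apply: le_trans wad.
  apply: le_trans (lambda_exp_mdist_le _ _ n).
  by apply: unstable_contract; rewrite ?bracket_bracketl.
(* In each time direction the images are compared through at most two
   intermediate orbits, whence the three thirds. *)
have e3E : e = e / 3 + (e / 3 + e / 3) by field.
apply: he => n.
  rewrite (le_trans (metric_triangle _ (iter n (@smap R Y) (f c0)) _))// e3E.
  apply: lerD; first by rewrite metric_sym fwd.
  by rewrite fc (le_trans (fwd _ _ n ca1))// lerDl ltW.
rewrite (le_trans (metric_triangle _ (iter n (@smapV R Y) (f a0)) _))// e3E.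
apply: lerD; first exact: bwd.
rewrite (le_trans (metric_triangle _ (iter n (@smapV R Y) (f a1)) _))//.
by apply: lerD; [exact: ae | rewrite metric_sym bwd].
Qed.

End FactorMap.

Theorem proposition2p9 (R : realType) (X Y : smaleSpace R) (f : X -> Y)
    (hf : s_resolving f) (n : nat) (a : 'I_n.+1 -> X)
    (ha : forall k : 'I_n.+1, unstable_equiv (f (a ord0)) (f (a k))) :
  exists b : 'I_n.+1 -> X,
    forall k : 'I_n.+1, unstable_equiv (a k) (b k) /\ f (b ord0) = f (b k).
Proof.
have ff := s_resolving_factor hf.
have [r r0 [e e0 hre]] := factor_bracket_eq ff.
have [s s0 hs] := bracket_near_diagonal X (eps_gt0 X).
have [G [GU ooG]] := ultraFilterLemma (F := \oo%classic : set_system nat) _.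
pose u (k : 'I_n.+1) (N : nat) := iter N (@smapV R X) (a k).
have /boolp.choice[c cu] : forall k, exists p : X, u k @ G --> p.
  move=> k; have := @spoint_compact R X; rewrite compact_ultra.
  by move=> /(_ (u k @ G) (fmap_ultra _ GU) filterT)[p [_ pG]]; exists p.
have fuE k N : f (u k N) = iter N (@smapV R Y) (f (a k)).
  exact: factor_iter_smapV.
have fu (k : 'I_n.+1) (d : R) : 0 < d -> \forall N \near \oo, forall m,
    mdist (iter (m + N) (@smapV R Y) (f (a ord0)))
          (iter (m + N) (@smapV R Y) (f (a k))) <= d.
  move=> d0; have /cvgr0Pnorm_le/(_ _ d0)[M _ HM] := ha k.
  exists M => // N MN m; apply: le_trans (HM (m + N)%N _).
    exact: ler_norm.
  by rewrite /= (leq_trans MN)// leq_addl.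
have fc k : f (c ord0) = f (c k).
  have fcvg j : (fun N => f (u j N)) @ G --> f (c j).
    by apply: (cvg_comp _ _ (cu j)); exact: (factor_continuous ff).
  (* The distance between the two image sequences tends to 0, so the limit of
     the one is also a limit of the other. *)
  apply: (cvg_unique (@metric_hausdorff _ Y) _ (fcvg k)) => //.
  apply/cvgrPdist_le => d d0; have d20 : 0 < d / 2 by rewrite divr_gt0.
  near=> N; rewrite (splitr d).
  apply: le_trans (metric_triangle _ (f (u ord0 N)) _) _; apply: lerD.
    by near: N; exact: (cvgr_dist_le (fcvg ord0)).
  rewrite !fuE.
  have : forall m, mdist (iter (m + N) (@smapV R Y) (f (a ord0)))
    (iter (m + N) (@smapV R Y) (f (a k))) <= d / 2.
    by near: N; apply: ooG; exact: fu.
  exact: (fun h => h 0%N).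
near G => N.
have caN k : mdist (c k) (u k N) <= Num.min r s.
  move: k; near: N; apply: filter_forall => k.
  by apply: (cvgr_dist_le (cu k)); rewrite lt_min r0.
have faN k m : mdist (iter m (@smapV R Y) (f (u ord0 N)))
                     (iter m (@smapV R Y) (f (u k N))) <= e.
  rewrite !fuE -!iterD; move: m; move: k; near: N.
  by apply: filter_forall => k; apply: ooG; exact: fu.
exists (fun k => iter N (@smap R X) (bracket (c k) (u k N))) => k.
split; last first.
  rewrite !(factor_iter_smap ff); congr (iter _ _); apply: hre => //.
  - by have := caN ord0; rewrite le_min => /andP[].
  - by have := caN k; rewrite le_min => /andP[].
rewrite -(iter_smapVK N (a k)).
apply/unstable_equiv_iter_smap/unstable_equiv_sym.
have := caN k; rewrite le_min => /andP[_ /hs[ca cw wa]].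
by apply: unstable_contract_equiv; rewrite ?bracket_bracketl.
Unshelve. all: by end_near. Qed.
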